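(* For each real $\epsilon > 0$, there is $\Delta_0 \in \mathbb{N}$ such that the following holds. Let $\Delta \geq \Delta_0$ be an integer and let $G$ be a triangle-free graph of maximum degree at most $\Delta$. Then, for every integer $q \geq (1+\epsilon)\Delta/\log\Delta$, we have $$c(G,q) \,\geq\, \left(1-\frac{1}{q}\right)^m \bigl((1-\delta)q\bigr)^n,$$ where $n = |V(G)|$, $m = |E(G)|$, and $\delta = 4\exp(\Delta/q)/q$.
   Context: All graphs are finite, undirected, and simple; $\log$ is the natural logarithm. For a graph $G$ and a positive integer $q$, $c(G,q)$ denotes the number of proper $q$-colorings of $G$, i.e., of maps $f \colon V(G) \to \{1,\ldots,q\}$ with $f(u)\neq f(v)$ whenever $uv \in E(G)$. *)

(* Defs.v *)
From HB Require Import structures.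
From mathcomp Require Import all_boot all_order all_algebra.

Set Implicit Arguments.
Unset Strict Implicit.
Unset Printing Implicit Defensive.

Record sgraph := SGraph {
  vertex :> finType;
  adj : rel vertex;
  adj_sym : symmetric adj;
  adj_irrefl : irreflexive adj }.

Definition edges (G : sgraph) : {set {set G}} :=
  [set [set p.1; p.2] | p : G * G & adj p.1 p.2].

Definition neighbors (G : sgraph) (v : G) : {set G} := [set w | adj v w].

Definition degree (G : sgraph) (v : G) : nat := #|neighbors v|.

Definition max_degree (G : sgraph) : nat := \max_(v : G) degree v.

Definition triangle_free (G : sgraph) : Prop :=
  forall u v w : G, ~ [/\ adj u v, adj v w & adj u w].

Definition proper_coloring (G : sgraph) (q : nat) (f : {ffun G -> 'I_q}) : bool :=
  [forall u : G, forall v : G, adj u v ==> (f u != f v)].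

Definition num_colorings (G : sgraph) (q : nat) : nat :=
  #|[set f : {ffun G -> 'I_q} | proper_coloring f]|.

(* Main.v *)
Require Import Defs.
From HB Require Import structures.
From mathcomp Require Import all_boot all_order all_algebra.
From mathcomp Require Import reals sequences exp.
From mathcomp Require Import ring lra.
Import Order.TTheory GRing.Theory Num.Theory.
Local Open Scope ring_scope.

Set Implicit Arguments.
Unset Strict Implicit.
Unset Printing Implicit Defensive.

(** Let [q] be the number of colors and [t = Delta / q].  The vertices are added
    one at a time to a set [S], and the number of colorings that are proper on [S]
    is followed, the vertices outside [S] being colored freely.  Adding [v]
    multiplies this number by [E |L(v)| / q], where [L(v)] is the list of colors
    available at [v] in a uniformly random coloring of [S].  So it is enough to
    bound this mean from below, by induction on [S].

    Fix the colors outside the neighborhood of [v].  As there is no triangle, the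
    neighborhood is independent, so its vertices [u] are colored independently and
    uniformly from their own lists [L(u)] ([resample_nbr]).  On average a color is
    then charged [1 / q] by each of the [d] neighbors, and convexity gives
    [E |L(v)| >= q exp(-d / q)] up to a relative error of order
    [1 / q] times the sum of the [1 / |L(u)|], where the lists with a single color
    count [t] times more ([mean_missed_ge]).

    Rosenfeld's idea makes this error computable: in a random coloring of [S], the
    mean of [1 / |L(u)|] is at most the number of colorings of [S :\ u], divided by
    [q] times the number of colorings of [S] ([sum_inv_avail]), which by induction
    is at most about [exp(d(u) / q) / q] with [d(u)] the degree of [u] in [S].
    Lists with a single color are rarer by a factor [t], by Chebyshev's inequality,
    because the events that two distinct colors are missed are negatively
    correlated ([few_missed], [few_avail_small]).

    Bounding every [d(u)] by [Delta] would lose a factor [t] in [delta].  It is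
    saved by letting [d(u)] grow with [S]: the successive losses caused by [u] are
    proportional to [exp(k / q) / q ^ 2] for distinct integers [k] below the
    degree of [u], hence sum to at most [exp(t) / q] up to a constant
    ([potential_U1]).  All this needs only that [(1 + t) ^ 3 * exp(t)] be small
    compared to [q], which is where [q >= (1 + eps) Delta / ln Delta] is used
    ([ln_regime]). *)

(** * Averages over a product of lists *)

Definition mean (R : fieldType) (X : finType) (A : {set X}) (F : X -> R) : R :=
  (\sum_(a in A) F a) / #|A|%:R.

Definition choices (T C : finType) (L : T -> {set C}) : {set {ffun T -> C}} :=
  [set h : {ffun T -> C} | [forall x, h x \in L x]].

Definition missed (T C : finType) (N : {set T}) (h : {ffun T -> C}) : {set C} :=
  [set c | [forall x in N, h x != c]].

Section Mean.
Variables (R : realType) (X : finType) (A : {set X}).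
Implicit Types F G : X -> R.

Lemma eq_mean F G : {in A, F =1 G} -> mean A F = mean A G.
Proof. by move=> FG; rewrite /mean (eq_bigr G). Qed.

Lemma ler_mean F G : {in A, forall a, F a <= G a} -> mean A F <= mean A G.
Proof. by move=> FG; rewrite /mean ler_wpM2r ?invr_ge0// ler_sum. Qed.

Lemma mean_sum (I : finType) (F : I -> X -> R) :
  mean A (fun a => \sum_i F i a) = \sum_i mean A (F i).
Proof. by rewrite /mean exchange_big /= mulr_suml. Qed.

Lemma meanD F G : mean A (fun a => F a + G a) = mean A F + mean A G.
Proof. by rewrite /mean big_split mulrDl. Qed.

Lemma meanZ (k : R) F : mean A (fun a => k * F a) = k * mean A F.
Proof. by rewrite /mean -mulr_sumr mulrA. Qed.

Hypothesis A0 : A != set0.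

Lemma mean_cst (k : R) : mean A (fun=> k) = k.
Proof.
by rewrite /mean sumr_const -(mulr_natr k) mulfK// pnatr_eq0 cards_eq0.
Qed.

Lemma mean_neq (c : X) :
  mean A (fun a => (a != c)%:R) = 1 - (c \in A)%:R / #|A|%:R :> R.
Proof.
rewrite -[X in X - _](mean_cst 1) /mean -mulrBl; congr (_ / _).
case: (boolP (c \in A)) => cA.
  rewrite (bigD1 c)//= [in RHS](bigD1 c)//= eqxx add0r addrAC subrr add0r.
  by apply: eq_bigr => a /andP[_ ->].
rewrite subr0; apply: eq_bigr => a aA.
by rewrite (_ : a != c = true)//; apply: contraNneq cA => <-.
Qed.

(** The events of avoiding either of two distinct values are negatively
    correlated: as hitting both is impossible, the two sides differ by the product of the probabilities of
    hitting each. *)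
Lemma mean_neq2 (c d : X) : c != d ->
  0 <= mean A (fun a => (a != c)%:R * (a != d)%:R : R)
    <= mean A (fun a => (a != c)%:R) * mean A (fun a => (a != d)%:R).
Proof.
move=> cd; apply/andP; split.
  by rewrite divr_ge0// sumr_ge0// => a _; rewrite mulr_ge0.
have -> : mean A (fun a => (a != c)%:R * (a != d)%:R)
    = 1 - (c \in A)%:R / #|A|%:R - (d \in A)%:R / #|A|%:R :> R.
  suff : mean A (fun a => (a != c)%:R * (a != d)%:R + 1) =
    mean A (fun a => (a != c)%:R + (a != d)%:R) :> R.
    by rewrite !meanD !mean_neq mean_cst; lra.
  apply: eq_mean => a _; have [->|] := eqVneq a c; last by rewrite mul1r addrC.
  by rewrite cd mul0r.
rewrite !mean_neq; have : 0 <= (c \in A)%:R / #|A|%:R * ((d \in A)%:R / #|A|%:R) :> R.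
  by rewrite mulr_ge0// divr_ge0.
nra.
Qed.

End Mean.

Section RandomChoice.
Variables (R : realType) (T C : finType) (L : T -> {set C}).
Hypothesis L0 : forall x, L x != set0.
Local Notation ell x := (#|L x|%:R : R).

Lemma ell_ge1 x : 1 <= ell x.
Proof. by rewrite ler1n card_gt0. Qed.

Lemma sum_choices_prod (F : T -> C -> R) :
  \sum_(h in choices L) \prod_x F x (h x) = \prod_x \sum_(c in L x) F x c.
Proof.
by rewrite bigA_distr_big_dep; apply: eq_bigl => h; rewrite inE; apply/forallP/familyP.
Qed.

Lemma card_choices : #|choices L|%:R = \prod_x ell x.
Proof.
rewrite -sum1_card natr_sum; transitivity (\sum_(h in choices L) \prod_(x : T) (1 : R)).
  by apply: eq_bigr => h _; rewrite big1.
rewrite (sum_choices_prod (fun _ _ => 1)).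
by apply: eq_bigr => x _; rewrite sumr_const.
Qed.

Lemma choices_neq0 : choices L != set0.
Proof.
rewrite -cards_eq0 -(pnatr_eq0 R) card_choices gt_eqF// prodr_gt0// => x _.
by rewrite ltr0n card_gt0.
Qed.

Lemma mean_choices_prod (F : T -> C -> R) :
  mean (choices L) (fun h => \prod_x F x (h x)) = \prod_x mean (L x) (F x).
Proof. by rewrite /mean sum_choices_prod card_choices prodf_div. Qed.

Variable N : {set T}.

Lemma in_missed (h : {ffun T -> C}) (c : C) :
  (c \in missed N h)%:R = \prod_x (if x \in N then (h x != c)%:R else 1) :> R.
Proof.
rewrite -big_mkcond /= inE; have [/forall_inP cN|] := boolP [forall x in N, h x != c].
  by rewrite big1// => x /cN ->.
case/forall_inPn => x xN; rewrite negbK => hx.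
by rewrite (bigD1 x)//= hx mul0r.
Qed.

Lemma card_missedE (h : {ffun T -> C}) :
  #|missed N h|%:R = \sum_c (c \in missed N h)%:R :> R.
Proof.
rewrite -sum1_card natr_sum [RHS](bigID (mem (missed N h)))/= [X in _ + X]big1 ?addr0.
  by apply: eq_bigr => c ->.
by move=> c /negbTE->.
Qed.

(** The probability that no vertex of [N] takes the color [c]. *)
Definition survival (c : C) : R := \prod_(x in N) (1 - (c \in L x)%:R / ell x).

(** The expected number of colors that no vertex of [N] takes. *)
Definition mean_missed : R := \sum_c survival c.

Lemma inv_ell_le1 c x : (c \in L x)%:R / ell x <= 1.
Proof.
rewrite ler_pdivrMr ?mul1r; last by rewrite (lt_le_trans ltr01) ?ell_ge1.
by case: (c \in L x); rewrite ?ell_ge1.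
Qed.

Lemma survival_ge0 c : 0 <= survival c.
Proof. by rewrite prodr_ge0// => x _; rewrite subr_ge0 inv_ell_le1. Qed.

Lemma mean_in_missed c :
  mean (choices L) (fun h => (c \in missed N h)%:R) = survival c.
Proof.
under eq_mean do rewrite in_missed.
rewrite (mean_choices_prod (fun x y => if x \in N then (y != c)%:R else 1)).
rewrite /survival [RHS]big_mkcond/=; apply: eq_bigr => x _.
by case: ifP => _; rewrite ?mean_neq ?mean_cst.
Qed.

Lemma mean_card_missed :
  mean (choices L) (fun h => #|missed N h|%:R) = mean_missed.
Proof.
under eq_mean do rewrite card_missedE.
by rewrite mean_sum; apply: eq_bigr => c _; rewrite mean_in_missed.
Qed.

Lemma mean_in_missed2 c d : c != d ->
  mean (choices L) (fun h => (c \in missed N h)%:R * (d \in missed N h)%:R)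
    <= survival c * survival d.
Proof.
move=> cd; under eq_mean do rewrite !in_missed -big_split/=.
rewrite (mean_choices_prod (fun x y => (if x \in N then (y != c)%:R else 1) *
  (if x \in N then (y != d)%:R else 1))).
rewrite -2!mean_in_missed.
under [X in _ <= X * _]eq_mean do rewrite in_missed.
under [X in _ <= _ * X]eq_mean do rewrite in_missed.
rewrite (mean_choices_prod (fun x y => if x \in N then (y != c)%:R else 1)).
rewrite (mean_choices_prod (fun x y => if x \in N then (y != d)%:R else 1)).
rewrite -big_split/=; apply: ler_prod => x _.
case: (x \in N); first exact: mean_neq2.
by under eq_mean do rewrite mulr1; rewrite !mean_cst// mulr1 lexx ler01.
Qed.

(** Negative correlation makes the variance at most the mean. *)
Lemma mean_card_missed2 :
  mean (choices L) (fun h => #|missed N h|%:R ^+ 2) <= mean_missed + mean_missed ^+ 2.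
Proof.
have -> : mean (choices L) (fun h => #|missed N h|%:R ^+ 2) =
  \sum_c \sum_d mean (choices L)
    (fun h => (c \in missed N h)%:R * (d \in missed N h)%:R) :> R.
  under eq_bigr do rewrite -mean_sum; rewrite -mean_sum; apply: eq_mean => h _.
  rewrite card_missedE expr2 mulr_suml; apply: eq_bigr => c _.
  by rewrite mulr_sumr.
rewrite expr2 {2}/mean_missed mulr_suml /mean_missed -big_split/=.
apply: ler_sum => c _; rewrite mulr_sumr (bigD1 c)//= lerD//.
  under eq_mean do rewrite -natrM mulnb andbb.
  by rewrite mean_in_missed.
rewrite [leRHS](bigD1 c)//= ler_wpDl ?mulr_ge0 ?survival_ge0//.
by apply: ler_sum => d dc; rewrite mean_in_missed2// eq_sym.
Qed.

(** Chebyshev's inequality, for a deviation of at least half the mean. *)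
Lemma few_missed : 2 <= mean_missed ->
  mean (choices L) (fun h => (#|missed N h| <= 1)%N%:R) <= 4 / mean_missed.
Proof.
set Z := mean_missed => Z2.
have Z0 : 0 < Z by lra.
apply: (@le_trans _ _ (mean (choices L) (fun h => 4 / Z ^+ 2 *
   (#|missed N h|%:R ^+ 2 + (- (2 * Z) * #|missed N h|%:R + Z ^+ 2))))).
  apply: ler_mean => h _; set k : R := #|_|%:R.
  rewrite -mulrA mulrCA mulrC ler_pdivlMr ?exprn_gt0//.
  have -> : k ^+ 2 + (- (2 * Z) * k + Z ^+ 2) = (k - Z) ^+ 2 by ring.
  case: leqP => [k1|_]; last by rewrite mul0r mulr_ge0// sqr_ge0.
  have k1' : k <= 1 by rewrite /k  (ler_nat _ _ 1).
  have : 0 <= (Z - 2 * k) * (3 * Z - 2 * k) by rewrite mulr_ge0//; lra.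
  by rewrite mul1r; nra.
rewrite meanZ !meanD meanZ mean_card_missed mean_cst ?choices_neq0//.
have := mean_card_missed2; rewrite -/Z => H.
have -> : 4 / Z = 4 / Z ^+ 2 * Z by field; rewrite gt_eqF.
by rewrite ler_wpM2l ?divr_ge0 ?sqr_ge0//; nra.
Qed.

Hypothesis C0 : (0 < #|C|)%N.
Local Notation q := (#|C|%:R : R).

(** Jensen's inequality would give the geometric mean of the survival
    probabilities, which vanishes as soon as some list is a singleton.  Instead,
    each survival probability is bounded below by the tangent at [x0 = #|N| / q]
    of the function [x |-> exp(-x)], where the exponent [X c] of the color [c]
    adds up the weights [w x] of the lists containing [c].  The weight of a
    singleton, which kills its color, is [1 + x0], so that the tangent is
    nonpositive there; any other weight is slightly more than the inverse of the
    length.  Each list contributes to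
    the sum of the [X c] its length times [w x], which is [1] plus a small
    error, and the terms [1] cancel the [x0] of the tangent.  The bound is
    linear in the errors, hence easy to average over colorings later. *)
Lemma mean_missed_ge (t : R) : #|N|%:R / q <= t ->
  q * expR (- (#|N|%:R / q)) *
    (1 - (\sum_(x in N) (2 / ell x + t * (#|L x| <= 1)%N%:R)) / q)
  <= mean_missed.
Proof.
have q0 : 0 < q by rewrite ltr0n.
set x0 := _ / q => x0t.
have x00 : 0 <= x0 by rewrite divr_ge0.
pose w x := if (#|L x| <= 1)%N then 1 + x0 else (ell x)^-1 + 2 * (ell x)^-1 ^+ 2.
pose X c := \sum_(x in N) (c \in L x)%:R * w x.
have w0 x : 0 <= w x.
  by rewrite /w; case: ifP => _; rewrite addr_ge0// ?mulr_ge0 ?sqr_ge0 ?invr_ge0.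
have tangent c : expR (- x0) * (1 + x0 - X c) <= survival c.
  have [/exists_inP[x xN /andP[cx x1]]|] :=
      boolP [exists x in N, (c \in L x) && (#|L x| <= 1)%N].
    apply: (le_trans _ (survival_ge0 c)).
    rewrite -(mulr0 (expR (- x0))) ler_wpM2l ?expR_ge0// subr_le0.
    rewrite /X (bigD1 x)//= cx mul1r {1}/w x1 lerDl sumr_ge0// => y _.
    by rewrite mulr_ge0.
  rewrite negb_exists_in => /forall_inP good.
  apply: (@le_trans _ _ (expR (- X c))).
    rewrite [in leRHS](_ : - X c = - x0 + (x0 - X c)); last by ring.
    by rewrite expRD ler_wpM2l ?expR_ge0// -addrA expR_ge1Dx.
  rewrite /X -sumrN expR_sum ler_prod// => x xN; rewrite expR_ge0/=.
  have := good x xN; case: (c \in L x) => /=; last by rewrite !mul0r subr0 oppr0 expR0.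
  rewrite mul1r -ltnNge /w => l2; rewrite leqNgt l2/= div1r.
  have lR : 2 <= ell x by rewrite ler_nat.
  set y := (ell x)^-1.
  have y0 : 0 < y by rewrite invr_gt0; lra.
  have y2 : y <= 2^-1 by rewrite lef_pV2// posrE; lra.
  rewrite expRN -[leRHS]invrK lef_pV2 ?posrE ?expR_gt0 ?invr_gt0//; last lra.
  apply: le_trans (expR_ge1Dx _).
  rewrite -[leLHS]mul1r ler_pdivrMr; last lra.
  have y12 : 0 <= 1 - 2 * y by lra.
  by have := mulr_ge0 (sqr_ge0 y) y12; nra.
apply: le_trans (ler_sum _ (fun c _ => tangent c)).
rewrite -mulr_sumr -mulrA mulrCA ler_wpM2l ?expR_ge0//.
rewrite sumrB sumr_const -(mulr_natr (1 + x0)).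
rewrite mulrBr mulr1 mulrCA mulfV ?gt_eqF// mulr1.
have -> : (1 + x0) * q = q + #|N|%:R.
  by rewrite /x0 mulrDl mul1r divfK ?gt_eqF.
suff : \sum_c X c <= #|N|%:R + \sum_(x in N) (2 / ell x + t * (#|L x| <= 1)%N%:R).
  by move=> ?; lra.
rewrite exchange_big/= -sum1_card natr_sum -big_split/=; apply: ler_sum => x xN.
rewrite -mulr_suml.
have -> : \sum_c (c \in L x)%:R = ell x.
  rewrite -sum1_card natr_sum [RHS]big_mkcond/=; apply: eq_bigr => c _.
  by case: (c \in L x).
have l1 := ell_ge1 x; have l0 : ell x != 0 by rewrite gt_eqF//; lra.
rewrite /w; case: leqP => h; last first.
  by rewrite mulr0 addr0 le_eqVlt; apply/orP; left; apply/eqP; field.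
have l1' : ell x <= 1 by rewrite (ler_nat _ _ 1).
have -> : ell x = 1 by lra.
by rewrite mul1r mulr1 divr1; lra.
Qed.

End RandomChoice.

(** * Proper colorings of an induced subgraph *)

(** If the blocks [choices (L f)] partition [P], then averaging over the block of
    each element preserves the total. *)
Lemma resample (R : realType) (T C : finType) (P : {set {ffun T -> C}})
    (L : {ffun T -> C} -> T -> {set C}) (F : {ffun T -> C} -> R) :
  {in P, forall f, f \in choices (L f)} ->
  (forall f h, f \in P -> h \in choices (L f) -> h \in P /\ L h =1 L f) ->
  \sum_(f in P) F f = \sum_(f in P) mean (choices (L f)) F.
Proof.
move=> PL inv.
have eq_choices (L1 L2 : T -> {set C}) : L1 =1 L2 -> choices L1 = choices L2.
  by move=> L12; apply/setP => h; rewrite !inE; apply: eq_forallb => x; rewrite L12.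
have sym f h : f \in P -> h \in P ->
    (h \in choices (L f)) = (f \in choices (L h)).
  by move=> fP hP; apply/idP/idP => [/(inv _ _ fP)|/(inv _ _ hP)] [_ /eq_choices];
    [move=> ->|move=> ->]; exact: PL.
transitivity (\sum_(f in P) \sum_(h in P | f \in choices (L h))
    F h / #|choices (L h)|%:R).
  rewrite [RHS](exchange_big_dep (mem P))/= => [|? ? _ /andP[]//].
  apply: eq_bigr => h hP.
  rewrite [RHS](eq_bigl (mem (choices (L h)))); last first.
    move=> f /=; apply/and3P/idP => [[]//|fh]; split=> //.
    by case: (inv h f hP fh).
  rewrite sumr_const -[RHS]mulr_natr divfK// pnatr_eq0 -lt0n card_gt0.
  by apply/set0Pn; exists h; exact: PL.
apply: eq_bigr => f fP; rewrite /mean mulr_suml.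
rewrite [LHS](_ : _ = \sum_(h in choices (L f)) F h / #|choices (L h)|%:R).
  by apply: eq_bigr => h hf; case: (inv f h fP hf) => _ /eq_choices ->.
apply: eq_bigl => h; apply/andP/idP => [[hP]|hf]; first by rewrite sym.
by case: (inv f h fP hf) => hP _; rewrite -sym.
Qed.

Section Colorings.
Variables (R : realType) (G : sgraph) (C : finType).
Implicit Types (S : {set G}) (u v : G) (f h : {ffun G -> C}).

(** Vertices outside [S] are colored arbitrarily: all the colorings live in one
    type, and [#|colorings S| / q ^ #|G|] is the probability that a uniformly
    random coloring is proper on [S]. *)
Definition colorings S : {set {ffun G -> C}} :=
  [set f : {ffun G -> C} | [forall u in S, forall v in S, adj u v ==> (f u != f v)]].

Definition nbr S v : {set G} := S :&: neighbors v.

Definition avail S f v : {set C} := missed (nbr S v) f.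

Lemma coloringsP S f :
  reflect {in S &, forall u v, adj u v -> f u != f v} (f \in colorings S).
Proof.
rewrite inE; apply: (iffP forall_inP) => [H u v uS vS|H u uS].
  by move/forall_inP: (H u uS) => /(_ v vS)/implyP.
by apply/forall_inP => v vS; apply/implyP; exact: H.
Qed.

Lemma availP S f v c :
  reflect {in S, forall u, adj v u -> f u != c} (c \in avail S f v).
Proof.
rewrite inE; apply: (iffP forall_inP) => H u; rewrite ?inE.
  by move=> uS vu; apply: H; rewrite !inE uS.
by case/andP; exact: H.
Qed.

Lemma mem_avail S f u : f \in colorings S -> u \in S -> f u \in avail S f u.
Proof.
by move/coloringsP => fS uS; apply/availP => w wS uw; apply: fS => //; rewrite adj_sym.
Qed.

Lemma eq_avail S f h v : {in nbr S v, f =1 h} -> avail S f v = avail S h v.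
Proof.
move=> fh; apply/setP => c; rewrite !inE; apply: eq_forallb_in => x xN.
by rewrite fh.
Qed.

Lemma nbrD1 S u : nbr (S :\ u) u = nbr S u.
Proof.
apply/setP => w; rewrite !inE; have [->|] //= := eqVneq w u.
by rewrite adj_irrefl andbF.
Qed.

Lemma availD1 S f u : avail (S :\ u) f u = avail S f u.
Proof. by rewrite /avail nbrD1. Qed.

Lemma coloringsU1 S f v : v \notin S ->
  (f \in colorings (v |: S)) = (f \in colorings S) && (f v \in avail S f v).
Proof.
move=> vS; apply/coloringsP/andP => [fvS|[/coloringsP fS /availP fv] x y].
  split; first by apply/coloringsP => x y xS yS; apply: fvS; rewrite inE ?xS ?yS orbT.
  apply/availP => u uS vu; apply: fvS; rewrite ?setU11 ?inE ?uS ?orbT//.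
  by rewrite adj_sym.
rewrite !inE => /orP[/eqP->|xS] /orP[/eqP->|yS].
- by rewrite adj_irrefl.
- by rewrite eq_sym; exact: fv.
- by rewrite adj_sym; exact: fv.
- exact: fS.
Qed.

Local Notation q := (#|C|%:R : R).
Local Notation num S := (#|colorings S|%:R : R).

(** The color of the new vertex [v], so far uniform, has to fall in the list
    of available colors of [v]. *)
Lemma sum_colorings_U1 S v (phi : nat -> R) : v \notin S ->
  \sum_(f in colorings (v |: S)) phi #|avail S f v| =
  (\sum_(f in colorings S) phi #|avail S f v| * #|avail S f v|%:R) / q.
Proof.
move=> vS.
pose L f x : {set C} := if x == v then setT else [set f x].
have agree f h : h \in choices (L f) -> forall x, x != v -> h x = f x.
  by rewrite inE => /forallP H x xv; have := H x; rewrite /L (negbTE xv) inE => /eqP.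
have agreeA f h : h \in choices (L f) -> avail S h v = avail S f v.
  move=> /agree hf; apply: eq_avail => x; rewrite !inE => /andP[xS _].
  by apply: hf; apply: contraNneq vS => <-.
rewrite (eq_bigl (fun f => (f \in colorings S) && (f v \in avail S f v))); last first.
  by move=> f; exact: coloringsU1.
rewrite big_mkcondr/= (resample (L := L)).
- rewrite mulr_suml; apply: eq_bigr => f fS.
  transitivity (mean (choices (L f)) (fun h => phi #|avail S f v| *
      \prod_x if x == v then (h x \in avail S f v)%:R else 1)).
    apply: eq_mean => h /agreeA ->.
    rewrite -big_mkcond big_pred1_eq.
    by case: ifP; rewrite ?mulr1 ?mulr0.
  rewrite meanZ -mulrA; congr (_ * _).
  rewrite (mean_choices_prod _ (fun x y => if x == v then (y \in avail S f v)%:R else 1)).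
  rewrite (bigD1 v)//= [X in _ * X]big1 ?mulr1; last first.
    move=> x xv; rewrite (negbTE xv) mean_cst// /L (negbTE xv).
    by apply/set0Pn; exists (f x); rewrite set11.
  rewrite eqxx /mean /L eqxx cardsT; congr (_ / _).
  rewrite -sum1_card natr_sum [RHS]big_mkcond/=.
  by apply: eq_big => c; rewrite ?inE// => _; case: ifP.
- move=> f _; rewrite inE; apply/forallP => x; rewrite /L.
  by case: ifP => _; rewrite inE.
- move=> f h fS hf; have ag := agree _ _ hf; split.
    apply/coloringsP => x y xS yS xy; rewrite !ag; last 2 first.
    + by apply: contraNneq vS => <-.
    + by apply: contraNneq vS => <-.
    by move/coloringsP: fS; apply.
  by move=> x; rewrite /L; case: eqVneq => // xv; rewrite ag.
Qed.

Lemma num_U1 S v : v \notin S ->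
  num (v |: S) = (\sum_(f in colorings S) #|avail S f v|%:R) / q.
Proof.
move=> vS; have := sum_colorings_U1 (fun=> 1) vS.
by rewrite -[num _]sumr_const => ->; under eq_bigr do rewrite mul1r.
Qed.

Definition few_avail S v : {set {ffun G -> C}} :=
  [set f in colorings S | (#|avail S f v| <= 1)%N].

(** A uniformly random coloring of [S] is one of [S :\ u] biased by the number of
    colors available at [u]: the bias cancels the inverse, so the mean of the
    inverse is at most a ratio of numbers of colorings. *)
Lemma sum_inv_avail S u : u \in S ->
  \sum_(f in colorings S) #|avail S f u|%:R^-1 <= num (S :\ u) / q.
Proof.
move=> uS; rewrite -{1}(setD1K uS).
under eq_bigr do rewrite -availD1.
rewrite (sum_colorings_U1 (fun k => k%:R^-1)) ?setD11//.
rewrite ler_wpM2r ?invr_ge0// -[leRHS]sumr_const ler_sum// => f _.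
have [->|k0] := eqVneq #|avail (S :\ u) f u| 0%N; first by rewrite mulr0.
by rewrite mulVf// pnatr_eq0.
Qed.

Lemma sum_few_avail S u : u \in S ->
  \sum_(f in colorings S) (#|avail S f u| <= 1)%N%:R <= #|few_avail (S :\ u) u|%:R / q :> R.
Proof.
move=> uS; rewrite -{1}(setD1K uS).
under eq_bigr do rewrite -availD1.
rewrite (sum_colorings_U1 (fun k => (k <= 1)%N%:R)) ?setD11//.
rewrite ler_wpM2r ?invr_ge0// -[leRHS]sumr_const.
rewrite [leRHS](eq_bigl (fun f => (f \in colorings (S :\ u)) &&
  (#|avail (S :\ u) f u| <= 1)%N)); last by move=> f; rewrite inE.
rewrite [leRHS]big_mkcondr/= ler_sum// => f _.
case: leqP => h; last by rewrite mul0r.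
by rewrite mul1r (ler_nat _ _ 1).
Qed.

Hypothesis G_tf : triangle_free G.

(** The lists from which the colors of the neighbors of [v] are redrawn; the
    singletons freeze every other vertex. *)
Definition lists S v f u : {set C} :=
  if u \in nbr S v then avail S f u else [set f u].

Lemma lists_neq0 S v f u : f \in colorings S -> lists S v f u != set0.
Proof.
move=> fS; apply/set0Pn; exists (f u); rewrite /lists.
by case: ifP => [|_]; rewrite ?set11// => /setIP[uS _]; exact: mem_avail.
Qed.

(** A neighborhood spans no edge, so recoloring it leaves the lists of its own
    vertices unchanged: this is the only place where triangles matter. *)
Lemma resample_nbr S v (F : {ffun G -> C} -> R) : v \notin S ->
  \sum_(f in colorings S) F f =
  \sum_(f in colorings S) mean (choices (lists S v f)) F.
Proof.
move=> vS; apply: resample => [f fS|f h fS hf].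
  rewrite inE; apply/forallP => x; rewrite /lists.
  by case: ifP => [|_]; rewrite ?set11// => /setIP[xS _]; exact: mem_avail.
have off x : x \notin nbr S v -> h x = f x.
  by move: hf; rewrite inE /lists => /forallP/(_ x); case: ifP => // _; rewrite inE => /eqP.
have on x : x \in nbr S v -> h x \in avail S f x.
  by move: hf; rewrite inE /lists => /forallP/(_ x); case: ifP.
have indep x y : x \in nbr S v -> y \in nbr S x -> y \notin nbr S v.
  rewrite !inE => /andP[_ vx] /andP[yS xy]; rewrite yS/=; apply/negP => vy.
  by apply: (G_tf (u := v) (v := x) (w := y)).
have same x : x \in nbr S v -> avail S h x = avail S f x.
  by move=> xN; apply: eq_avail => y /(indep _ _ xN)/off.
split.
  apply/coloringsP => x y xS yS xy.
  have [xN|xN] := boolP (x \in nbr S v).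
    have yN : y \notin nbr S v by apply: indep xN _; rewrite !inE yS.
    rewrite (off _ yN) eq_sym; move/availP: (on _ xN); exact.
  rewrite (off _ xN); have [yN|yN] := boolP (y \in nbr S v).
    by move/availP: (on _ yN); apply=> //; rewrite adj_sym.
  by rewrite (off _ yN); move/coloringsP: fS; apply.
by move=> x; rewrite /lists; case: ifP => [/same//|/negbT/off ->].
Qed.

Hypothesis C0 : (0 < #|C|)%N.
Variable (t : R).

Local Notation d S v := (#|nbr S v|%:R : R).

(** The number of colors available at [v] is averaged over the block of each
    coloring by [mean_missed_ge]; the averages of the errors over all colorings
    are then given by [sum_inv_avail] and [sum_few_avail]. *)
Lemma num_U1_ge S v : v \notin S -> d S v / q <= t ->
  expR (- (d S v / q)) * (num S - (\sum_(u in nbr S v)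
    (2 * num (S :\ u) + t * #|few_avail (S :\ u) u|%:R)) / q ^+ 2) <= num (v |: S).
Proof.
move=> vS dt; have q0 : 0 < q by rewrite ltr0n.
have t0 : 0 <= t by apply: le_trans dt; rewrite divr_ge0.
rewrite num_U1// (resample_nbr _ vS).
rewrite ler_pdivlMr//.
pose loss f := \sum_(u in nbr S v)
  (2 / #|avail S f u|%:R + t * (#|avail S f u| <= 1)%N%:R) : R.
apply: (@le_trans _ _ (\sum_(f in colorings S)
    q * expR (- (d S v / q)) * (1 - loss f / q))); last first.
  apply: ler_sum => f fS; have L0 u := lists_neq0 v u fS.
  rewrite mean_card_missed//; apply: le_trans (mean_missed_ge L0 C0 dt).
  rewrite le_eqVlt; apply/orP; left; apply/eqP; congr (_ * (1 - _ / _)).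
  by apply: eq_bigr => u uN; rewrite /lists uN.
rewrite -mulr_sumr sumrB sumr_const -mulr_suml [leLHS]mulrAC [in leLHS](mulrC _ q).
apply: ler_wpM2l; first by rewrite mulr_ge0 ?expR_ge0// ltW.
rewrite lerB//.
rewrite expr2 invfM mulrA ler_wpM2r ?invr_ge0 ?(ltW q0)//.
rewrite exchange_big/= mulr_suml; apply: ler_sum => u /setIP[uS _].
rewrite big_split/= -!mulr_sumr [leRHS]mulrDl -!mulrA.
by rewrite lerD// ler_wpM2l// ?sum_inv_avail ?sum_few_avail.
Qed.

(** Either the error in [mean_missed_ge] is large, which Markov's inequality
    makes rare, or the conditional mean is at least [q / (2 exp(t))] and
    Chebyshev's inequality applies. *)
Lemma few_avail_le S v : v \notin S -> d S v / q <= t -> 4 * expR t <= q ->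
  #|few_avail S v|%:R <= 2 * (t + 2) / q ^+ 2 * \sum_(u in nbr S v) num (S :\ u) +
    8 * expR t / q * num S.
Proof.
move=> vS dt tq; have q0 : 0 < q by rewrite ltr0n.
have t0 : 0 <= t by apply: le_trans dt; rewrite divr_ge0.
have -> : #|few_avail S v|%:R = \sum_(f in colorings S) (#|avail S f v| <= 1)%N%:R :> R.
  rewrite -sum1_card natr_sum (eq_bigl (fun f => (f \in colorings S) &&
    (#|avail S f v| <= 1)%N)) => [|f]; last by rewrite inE.
  by rewrite big_mkcondr; apply: eq_bigr => f _; case: ifP.
rewrite (resample_nbr _ vS).
pose A f := \sum_(u in nbr S v) #|avail S f u|%:R^-1 : R.
apply: (@le_trans _ _ (\sum_(f in colorings S)
    (2 * (t + 2) / q * A f + 8 * expR t / q))); last first.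
  rewrite big_split/= sumr_const -(mulr_natr (8 * expR t / q)) lerD2r -mulr_sumr.
  rewrite [leRHS](_ : _ = 2 * (t + 2) / q * (\sum_(u in nbr S v) num (S :\ u) / q)).
    rewrite ler_wpM2l ?divr_ge0 ?mulr_ge0 ?addr_ge0 ?(ltW q0)//.
    rewrite /A exchange_big/=; apply: ler_sum => u /setIP[uS _].
    exact: sum_inv_avail.
  by rewrite -mulr_suml; field; rewrite gt_eqF.
apply: ler_sum => f fS; have L0 u := lists_neq0 v u fS.
have A0 : 0 <= A f by rewrite sumr_ge0// => u _; rewrite invr_ge0.
have e0 := expR_gt0 t.
(* In the first case the error exceeds one half and the claimed bound exceeds 1. *)
have [big|small] := lerP q (2 * (t + 2) * A f).
  apply: (@le_trans _ _ (mean (choices (lists S v f)) (fun=> 1))).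
    by apply: ler_mean => h _; case: (_ <= _)%N.
  rewrite mean_cst ?(choices_neq0 R)//.
  rewrite -[leLHS]addr0 lerD ?divr_ge0 ?mulr_ge0 ?(ltW q0) ?(ltW e0)//.
  by rewrite mulrAC ler_pdivlMr// mul1r.
have Z : q / (2 * expR t) <= mean_missed R (lists S v f) (nbr S v).
  apply: le_trans (mean_missed_ge L0 C0 dt).
  rewrite -mulrA ler_wpM2l ?(ltW q0)// invfM mulrC -expRN.
  apply: ler_pM; rewrite ?invr_ge0 ?expR_ge0//.
    by rewrite ler_expR lerN2.
  rewrite lerBrDr -lerBrDl ler_pdivrMr//.
  apply: (@le_trans _ _ ((t + 2) * A f)); last by lra.
  rewrite /A mulr_sumr; apply: ler_sum => u uN; rewrite /lists uN (mulrDl t 2) addrC.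
  rewrite lerD2r ler_wpM2l//; case: leqP => h; last by rewrite invr_ge0.
  rewrite (_ : #|avail S f u| = 1%N) ?invr1//; apply/eqP.
  by rewrite eqn_leq h card_gt0; have := L0 u; rewrite /lists uN.
have Zq : 2 <= q / (2 * expR t) by rewrite ler_pdivlMr ?mulr_gt0//; lra.
apply: le_trans (few_missed L0 (le_trans Zq Z)) _.
apply: (@le_trans _ _ (8 * expR t / q)); last first.
  by rewrite lerDr mulr_ge0 ?divr_ge0 ?mulr_ge0 ?addr_ge0// ltW.
apply: (@le_trans _ _ (4 / (q / (2 * expR t)))).
  by rewrite ler_wpM2l// lef_pV2// posrE; lra.
by rewrite le_eqVlt; apply/orP; left; apply/eqP; field; rewrite !gt_eqF.
Qed.

End Colorings.

(** * Adding the vertices one at a time *)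

Section Induction.
Variables (R : realType) (G : sgraph) (C : finType) (t : R).
Hypothesis G_tf : triangle_free G.
Implicit Types (S : {set G}) (u v : G).
Local Notation q := (#|C|%:R : R).
Local Notation num S := (#|colorings C S|%:R : R).
Local Notation d S v := (#|nbr S v|%:R : R).
Local Notation num_few S v := (#|few_avail C S v|%:R : R).
Hypothesis t0 : 0 <= t.
Hypothesis deg_le : forall v, #|neighbors v|%:R <= t * q.
Hypothesis q_large : 32 * (1 + t) ^+ 3 * expR t <= q.

Lemma q_large_weak p : 0 <= p <= (1 + t) ^+ 3 -> 32 * (p * expR t) <= q.
Proof.
case/andP=> p0 pt; apply: le_trans q_large; rewrite -mulrA ler_wpM2l//.
by rewrite ler_wpM2r ?expR_ge0.
Qed.

Lemma q_ge32 : 32 <= q.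
Proof.
have := @q_large_weak 1; rewrite mul1r ler01 exprn_ege1 ?lerDl//= => /(_ isT).
by move: t0 (expR_ge1Dx t) => h0 h1 h; lra.
Qed.

Let q0 : 0 < q. Proof. by have := q_ge32; lra. Qed.

Let C0 : (0 < #|C|)%N. Proof. by rewrite -(ltr0n R). Qed.

Lemma nbr_le S v : d S v <= t * q.
Proof. by apply: le_trans (deg_le v); rewrite ler_nat subset_leq_card ?subsetIr. Qed.

Lemma nbr_le_div S v : d S v / q <= t.
Proof. by rewrite ler_pdivrMr// nbr_le. Qed.

Lemma sum_nbr_le S v (F : G -> R) (k : R) : {in nbr S v, forall u, F u <= k} ->
  0 <= k -> \sum_(u in nbr S v) F u <= t * q * k.
Proof.
move=> Fk k0; apply: (@le_trans _ _ (\sum_(u in nbr S v) k)); first exact: ler_sum.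
by rewrite sumr_const -(mulr_natl k) ler_wpM2r// nbr_le.
Qed.

(** The weak form of the counting bound that the induction carries: deleting [u]
    does not multiply the number of colorings by more than it should, up to a
    constant. *)
Definition good_ratio S := {in S, forall u,
  num (S :\ u) <= 5 / 4 * expR (d S u / q) * num S}.

(** In [num_U1_ge] a list with at most one color costs [t] times more than its
    inverse length would; the second moment makes such lists rarer than [1 / t],
    which absorbs that factor. *)
Lemma few_avail_small S v : v \notin S -> good_ratio S -> t * num_few S v <= num S / 4.
Proof.
move=> vS good; have e1 : 0 < expR t := expR_gt0 t; have ht := t0.
have tq : 4 * expR t <= q.
  have := @q_large_weak 1; rewrite mul1r ler01 exprn_ege1 ?lerDl//= => /(_ isT) h; lra.
have := few_avail_le G_tf C0 vS (nbr_le_div S v) tq.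
have : \sum_(u in nbr S v) num (S :\ u) <= t * q * (5 / 4 * expR t * num S).
  apply: sum_nbr_le => [u /setIP[uS _]|]; last by rewrite !mulr_ge0 ?invr_ge0 ?(ltW e1).
  apply: le_trans (good u uS) _; rewrite ler_wpM2r// ler_wpM2l ?divr_ge0//.
  by rewrite ler_expR nbr_le_div.
set s := \sum_(u in _) _ => sle fle.
have {}fle : num_few S v <= (5 / 2 * t * (t + 2) + 8) * expR t / q * num S.
  apply: le_trans fle _.
  rewrite [leRHS](_ : _ = 2 * (t + 2) / q ^+ 2 * (t * q * (5 / 4 * expR t * num S))
     + 8 * expR t / q * num S); last by field; rewrite gt_eqF.
  by rewrite lerD2r ler_wpM2l// divr_ge0 ?exprn_ge0 ?(ltW q0)//; lra.
apply: le_trans (ler_wpM2l t0 fle) _.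
rewrite mulrA mulrC ler_wpM2l// !mulrA ler_pdivrMr//.
have /q_large_weak : 0 <= t * (5 / 2 * t * (t + 2) + 8) / 8 <= (1 + t) ^+ 3.
  have ht' := t0; have t2 := mulr_ge0 ht' ht'; have t3 := mulr_ge0 ht' t2.
  by rewrite !exprS expr0; apply/andP; split; nra.
by lra.
Qed.

(** The relative error made when [v] is added to [S].  The constant [3] bounds
    [(2 + 1 / 4) * (5 / 4)], from the factor [2] and the contribution of the
    short lists in [num_U1_ge], and from the constant of [good_ratio]. *)
Definition loss S v : R := 3 / q ^+ 2 * \sum_(u in nbr S v) expR (d S u / q).

Lemma loss_ge0 S v : 0 <= loss S v.
Proof.
rewrite mulr_ge0 ?divr_ge0 ?exprn_ge0 ?(ltW q0)//.
by rewrite sumr_ge0// => u _; rewrite expR_ge0.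
Qed.

Lemma loss_le S v : loss S v <= 5^-1.
Proof.
have : \sum_(u in nbr S v) expR (d S u / q) <= t * q * expR t.
  by apply: sum_nbr_le => [u _|]; rewrite ?expR_ge0// ler_expR nbr_le_div.
have /q_large_weak : 0 <= t <= (1 + t) ^+ 3.
  have ht' := t0; have t2 := mulr_ge0 ht' ht'; have t3 := mulr_ge0 ht' t2.
  by rewrite !exprS expr0; apply/andP; split; nra.
move=> h1 h2; apply: (@le_trans _ _ (3 / q ^+ 2 * (t * q * expR t))).
  by rewrite ler_wpM2l// divr_ge0 ?exprn_ge0 ?(ltW q0).
rewrite [leLHS](_ : _ = 3 * t * expR t / q); last by field; rewrite gt_eqF.
by rewrite ler_pdivrMr//; have := ltW q0; lra.
Qed.

Lemma num_U1_ge_loss S v : v \notin S -> good_ratio S ->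
    {in S, forall u, good_ratio (S :\ u)} ->
  expR (- (d S v / q)) * (1 - loss S v) * num S <= num (v |: S).
Proof.
move=> vS good good1; apply: le_trans (num_U1_ge G_tf C0 vS (nbr_le_div S v)).
rewrite -mulrA ler_wpM2l ?expR_ge0// mulrBl mul1r lerB//.
rewrite /loss (mulrAC 3) [leRHS]mulrAC; apply: ler_wpM2r.
  by rewrite invr_ge0 exprn_ge0// ltW.
rewrite -mulrA mulr_suml mulr_sumr; apply: ler_sum => u /setIP[uS _].
have := few_avail_small (negbT (setD11 u S)) (good1 u uS).
by have := good u uS; have := mulr_ge0 (expR_ge0 (d S u / q)) (ler0n R #|colorings C S|); lra.
Qed.

(** Adding [u] back to [S :\ u] involves only the ratios at sets smaller than
    [S]. *)
Lemma all_good_ratio S : good_ratio S.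
Proof.
have [n] := ubnP #|S|; elim: n S => // n IH S Sn u uS.
have u1 : u \notin S :\ u by rewrite setD11.
have Su : (#|S :\ u| < n)%N by move: Sn; rewrite (cardsD1 u S) uS.
have good1 : {in S :\ u, forall w, good_ratio (S :\ u :\ w)}.
  move=> w _; apply: IH; apply: leq_ltn_trans Su.
  by rewrite subset_leq_card// subD1set.
have := num_U1_ge_loss u1 (IH _ Su) good1.
rewrite setD1K// nbrD1 expRN -mulrA ler_pdivrMl ?expR_gt0// => h.
have : 4 / 5 * num (S :\ u) <= (1 - loss (S :\ u) u) * num (S :\ u).
  by rewrite ler_wpM2r//; have := loss_le (S :\ u) u; lra.
by move: h; lra.
Qed.

Definition inner_edges S : {set {set G}} := [set E in edges G | E \subset S].

Lemma inner_edges_U1 S v : v \notin S ->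
  (#|inner_edges S| + #|nbr S v| <= #|inner_edges (v |: S)|)%N.
Proof.
move=> vS; pose star := [set [set v; u] | u in nbr S v].
have -> : #|nbr S v| = #|star|.
  rewrite card_in_imset// => x y /setIP[xS _] _ /setP/(_ x).
  rewrite !inE eqxx orbT => /esym/orP[/eqP xv|/eqP//].
  by move: vS; rewrite -xv xS.
rewrite -cardsUI [X in (_ + X)%N](_ : _ = 0%N) ?addn0; last first.
  apply/eqP; rewrite cards_eq0; apply/eqP/setP => E; rewrite !inE.
  apply/negP => /andP[/andP[_ ES] /imsetP[u _ Eu]]; move: vS.
  by rewrite (subsetP ES)// Eu set21.
apply: subset_leq_card; apply/subsetP => E; rewrite !inE => /orP[/andP[-> ES]|].
  by rewrite (subset_trans ES) ?subsetUr.
case/imsetP => u; rewrite !inE => /andP[uS vu] ->; apply/andP; split.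
  by apply/imsetP; exists (v, u); rewrite ?inE.
by apply/subsetP => x; rewrite !inE => /orP[]/eqP->; rewrite ?eqxx ?uS ?orbT.
Qed.

(** A vertex [u] suffers a loss each time one of its neighbors is added, in
    proportion to [exp(k / q)] where [k] is its current degree.  The losses form
    a Riemann sum of the exponential, so up to degree [d] they add up to
    [exp(d / q)] and not to [d / q] times that.  The potential of [S] dominates
    all the losses made so far; its constant [4] is the constant [3] of [loss]
    times the [4 / 3] of the inequality [exp(- 4 / 3 * x) <= 1 - x], valid for
    [0 <= x <= 1 / 4]. *)
Definition potential S : R := 4 / q * \sum_(u in S) (expR (d S u / q) - 1).

Lemma potential_U1 S v : v \notin S ->
  potential S + 4 / 3 * loss S v <= potential (v |: S).
Proof.
move=> vS; rewrite /potential big_setU1//= mulrDr.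
have pos : 0 <= 4 / q * (expR (d (v |: S) v / q) - 1).
  by rewrite mulr_ge0 ?divr_ge0 ?(ltW q0)// subr_ge0 -[leLHS]expR0 ler_expR divr_ge0.
apply: ler_wpDl pos _.
have -> : 4 / 3 * loss S v = 4 / q * \sum_(u in nbr S v) expR (d S u / q) / q.
  by rewrite /loss -mulr_suml; field; rewrite gt_eqF.
rewrite -mulrDr ler_wpM2l ?divr_ge0 ?(ltW q0)//.
rewrite [X in _ + X](eq_bigl (fun u => (u \in S) && (u \in neighbors v))); last first.
  by move=> u; rewrite in_setI.
rewrite big_mkcondr/= -big_split/=; apply: ler_sum => u uS.
case: ifPn => vu; last first.
  rewrite addr0 lerD2r ler_expR ler_wpM2r ?invr_ge0 ?(ltW q0)// ler_nat.
  by rewrite subset_leq_card// setSI// subsetUr.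
have -> : nbr (v |: S) u = v |: nbr S u.
  by rewrite /nbr setIUl (setIidPl _)// sub1set inE adj_sym; rewrite inE in vu.
rewrite cardsU1 inE (negbTE vS)/= natrD mulrDl expRD [leRHS]addrC [leRHS]addrC.
rewrite addrAC lerD2r -{1}[expR _]mulr1 -mulrDr mulrC ler_wpM2r ?expR_ge0//.
by rewrite div1r expR_ge1Dx.
Qed.

Lemma num_ge S :
  q ^+ #|G| * (1 - 1 / q) ^+ #|inner_edges S| * expR (- potential S) <= num S.
Proof.
have q1 : 0 <= 1 - 1 / q <= 1.
  rewrite lerBlDr lerDl subr_ge0 ler_pdivrMr// divr_ge0 ?(ltW q0)//.
  by have := q_ge32; lra.
have [n] := ubnP #|S|; elim: n S => // n IH S Sn.
have [->|[u uS]] := set_0Vmem S.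
  rewrite /potential big_set0 mulr0 oppr0 expR0 mulr1.
  have -> : colorings C (set0 : {set G}) = setT.
    by apply/setP => f; rewrite in_setT; apply/coloringsP => x y; rewrite inE.
  rewrite cardsT card_ffun natrX -[leRHS]mulr1 ler_wpM2l ?exprn_ge0//.
  by case/andP: q1; exact: exprn_ile1.
have u1 : u \notin S :\ u by rewrite setD11.
have Su : (#|S :\ u| < n)%N by move: Sn; rewrite (cardsD1 u S) uS.
have step := num_U1_ge_loss u1 (@all_good_ratio _) (fun w _ => @all_good_ratio _).
have pot := potential_U1 u1; have edg := inner_edges_U1 u1.
rewrite !setD1K// in step pot edg.
apply: le_trans step; set x := loss _ _ in pot *; set k := #|nbr _ _| in edg *.
have x5 : x <= 5^-1 := loss_le _ _; have x0 : 0 <= x := loss_ge0 _ _.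
have ek : (1 - 1 / q) ^+ k <= expR (- (k%:R / q)).
  have -> : - (k%:R / q) = k%:R * (- (1 / q)) by rewrite mulrN div1r.
  rewrite expRM_natl; case/andP: q1 => q1 _.
  by rewrite lerXn2r ?nnegrE ?expR_ge0// expR_ge1Dx.
have ex : expR (- (4 / 3 * x)) <= 1 - x.
  rewrite expRN -[leRHS]invrK lef_pV2 ?posrE ?expR_gt0 ?invr_gt0//; last lra.
  apply: le_trans (expR_ge1Dx _); rewrite -[leLHS]mul1r ler_pdivrMr; last lra.
  have x4 : 0 <= 1 - 4 * x by lra.
  by have := mulr_ge0 x0 x4; nra.
have q1k := exprn_ge0 k (andP q1).1.
apply: (@le_trans _ _ ((1 - 1 / q) ^+ k * expR (- (4 / 3 * x)) *
   (q ^+ #|G| * (1 - 1 / q) ^+ #|inner_edges (S :\ u)| * expR (- potential (S :\ u))))).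
  have mulrACA5 (a b c e f : R) : a * b * (c * e * f) = c * (e * a) * (f * b) by ring.
  rewrite mulrACA5.
  rewrite -exprD -expRD -!mulrA ler_wpM2l ?exprn_ge0//.
  apply: ler_pM; rewrite ?expR_ge0 ?exprn_ge0 ?(andP q1).1//.
    by case/andP: q1 => q1 q1'; rewrite ler_wiXn2l.
  by rewrite ler_expR; lra.
apply: ler_pM; last exact: IH.
- by rewrite mulr_ge0// expR_ge0.
- by rewrite !mulr_ge0 ?expR_ge0 ?exprn_ge0 ?(andP q1).1.
- by apply: ler_pM => //; rewrite expR_ge0.
Qed.

End Induction.

(** * The range of the number of colors *)

Section Asymptotics.
Variable R : realType.

Lemma expR_dominates (a : R) : 0 < a -> exists M : R, 1 <= M /\
  forall y, M <= y -> 256 * y ^+ 4 <= expR (a * y).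
Proof.
move=> a0; pose b := (a / 5) ^+ 5.
have b0 : 0 < b by rewrite exprn_gt0// divr_gt0.
exists (1 + 256 / b); split=> [|y My]; first by rewrite lerDl divr_ge0// ltW.
have cb : 0 < 256 / b by rewrite divr_gt0.
have y0 : 0 <= y by lra.
(* [exp(a y)] is the fifth power of [exp(a y / 5)], one degree more than needed. *)
have -> : a * y = 5%:R * (a / 5 * y) by field.
rewrite expRM_natl; apply: (@le_trans _ _ ((a / 5 * y) ^+ 5)).
  rewrite exprMn -/b (exprS y 4) [leRHS]mulrA ler_wpM2r ?exprn_ge0//.
  by rewrite mulrC -ler_pdivrMr//; lra.
have z0 : 0 <= a / 5 * y by rewrite !mulr_ge0 ?invr_ge0 ?(ltW a0).
rewrite lerXn2r ?nnegrE ?expR_ge0//.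
by have := expR_ge1Dx (a / 5 * y); lra.
Qed.

(** With [y = ln Delta], the ratio [t = Delta / q] is at most [y / (1 + eps)],
    so [exp(t)] falls short of [Delta] by the power [exp(y * eps / (1 + eps))],
    which beats every polynomial in [y]. *)
Lemma ln_regime (eps : R) : 0 < eps -> exists Delta0 : nat,
  forall Delta : nat, (Delta0 <= Delta)%N -> forall q : R,
  (1 + eps) * Delta%:R / ln Delta%:R <= q ->
  0 < q /\ 32 * (1 + Delta%:R / q) ^+ 3 * expR (Delta%:R / q) <= q.
Proof.
move=> eps0; have a0 : 0 < eps / (1 + eps) by rewrite divr_gt0//; lra.
have [M [M1 MP]] := expR_dominates a0.
exists (Num.trunc (expR M)).+1 => D DD q qD.
have D0 : 0 < D%:R :> R by rewrite ltr0n (leq_trans _ DD).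
set y := ln D%:R in qD.
have My : M <= y.
  rewrite -ler_expR /y lnK ?posrE// ltW// (lt_le_trans (truncnS_gt _))//.
  by rewrite ler_nat.
have y0 : 0 < y by lra.
have Dy : D%:R = expR y by rewrite /y lnK ?posrE.
have e0 : 0 < 1 + eps by lra.
have q0 : 0 < q by apply: lt_le_trans qD; rewrite divr_gt0 ?mulr_gt0.
split=> //; set t := _ / q.
have t0 : 0 <= t by rewrite divr_ge0// ltW.
have ty : t <= y / (1 + eps).
  rewrite /t ler_pdivrMr// mulrC mulrA ler_pdivlMr// mulrC.
  by move: qD; rewrite ler_pdivrMr// => qD; lra.
have ty' : t <= y.
  apply: le_trans ty _; rewrite ler_pdivrMr//.
  by have := mulr_gt0 y0 eps0; lra.
(* As [1 <= y] and [t <= y], the polynomial factor [32 * (1 + t) ^ 3 * y] is at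
   most [256 * y ^ 4]. *)
apply: (@le_trans _ _ (32 * (2 * y) ^+ 3 * expR (y / (1 + eps)))).
  apply: ler_pM; rewrite ?mulr_ge0 ?exprn_ge0 ?expR_ge0 ?ler_expR//; try lra.
  by rewrite ler_wpM2l// lerXn2r ?nnegrE//; lra.
apply: (@le_trans _ _ (expR y / y)).
  rewrite ler_pdivlMr//.
  have -> : expR y = expR (eps / (1 + eps) * y) * expR (y / (1 + eps)).
    by rewrite -expRD; congr expR; field; rewrite gt_eqF.
  rewrite mulrAC ler_wpM2r ?expR_ge0//; apply: le_trans (MP y My).
  by rewrite le_eqVlt; apply/orP; left; apply/eqP; ring.
apply: le_trans qD; rewrite -Dy ler_wpM2r ?invr_ge0 ?(ltW y0)//.
by have := mulr_gt0 eps0 D0; lra.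
Qed.

End Asymptotics.

(** * The counting theorem *)

Theorem theorem1p2 (R : realType) (eps : R) (eps_gt0 : 0 < eps) :
  exists Delta0 : nat, forall Delta : nat, (Delta0 <= Delta)%N ->
  forall G : sgraph, triangle_free G -> (max_degree G <= Delta)%N ->
  forall q : nat, (1 + eps) * Delta%:R / ln (Delta%:R : R) <= q%:R ->
  let n := #|G| in
  let m := #|edges G| in
  let delta : R := 4 * expR (Delta%:R / q%:R) / q%:R in
  (1 - 1 / q%:R) ^+ m * ((1 - delta) * q%:R) ^+ n <= (num_colorings G q)%:R.
Proof.
have [Delta0 regime] := ln_regime eps_gt0.
exists Delta0 => Delta large G G_tf deg q /(regime _ large)[q0 q_large]; cbv zeta.
set t := Delta%:R / q%:R in q_large *.
set delta := 4 * _ / _; set n := #|G|.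
have t0 : 0 <= t by rewrite divr_ge0// ltW.
have deg_le (v : G) : #|neighbors v|%:R <= t * #|'I_q|%:R.
  rewrite card_ord divfK ?gt_eqF// ler_nat; apply: leq_trans deg.
  exact: (leq_bigmax v).
have q_large' : 32 * (1 + t) ^+ 3 * expR t <= #|'I_q|%:R by rewrite card_ord.
have bound := num_ge G_tf t0 deg_le q_large' setT.
have -> : num_colorings G q = #|colorings 'I_q [set: G]|.
  apply: eq_card => f; rewrite [LHS]inE; apply/forallP/coloringsP => [fP u v _ _|fP u].
    by move/forallP: (fP u) => /(_ v)/implyP.
  by apply/forallP => v; apply/implyP; apply: fP; rewrite inE.
apply: le_trans bound; rewrite card_ord.
have -> : inner_edges [set: G] = edges G.
  by apply/setP => E; rewrite inE subsetT andbT.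
rewrite -/n exprMn mulrCA mulrA mulrAC.
have q32 : 32 <= q%:R :> R.
  by have := q_ge32 t0 q_large'; rewrite card_ord.
rewrite -[leLHS]mulrA [leLHS]mulrC; apply: ler_wpM2l.
  by rewrite mulr_ge0 ?exprn_ge0 ?(ltW q0)// subr_ge0 ler_pdivrMr//; lra.
have delta1 : delta <= 1.
  have := q_large_weak (p := 1) q_large'; rewrite card_ord mul1r.
  rewrite ler01 exprn_ege1 ?lerDl//= => /(_ isT) h.
  by rewrite /delta ler_pdivrMr// mul1r; have := expR_gt0 t; lra.
apply: (@le_trans _ _ (expR (n%:R * - delta))).
  by rewrite expRM_natl lerXn2r ?nnegrE ?expR_ge0 ?expR_ge1Dx// subr_ge0.
rewrite ler_expR mulrN lerN2 /potential card_ord.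
have -> : n%:R * delta = 4 / q%:R * \sum_(u in [set: G]) expR t.
  rewrite sumr_const cardsT -/n -(mulr_natl (expR t)) /delta.
  by field; rewrite gt_eqF.
rewrite ler_wpM2l ?divr_ge0 ?(ltW q0)//; apply: ler_sum => u _.
rewrite lerBlDr ler_wpDr// ler_expR.
by have := nbr_le_div t0 deg_le q_large' setT u; rewrite card_ord.
Qed.
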